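(* Let $n\ge 3$, $\mathfrak g=\mathfrak{so}(2n+1,\mathbb C)$, and let $\lambda=(\lambda_1,\dots,\lambda_n)\in\mathbb C^n$. Let $(\Phi_{\lambda,a^{(0)},b^{(0)}},V)$ be the specialized Schnizer module of $U_\varepsilon(\mathfrak{so}(2n+1,\mathbb C))$ defined in the context. Then a vector $u\in V$ satisfies $e_iu=0$ for all $i\in\{1,\dots,n\}$ if and only if $u\in\mathbb C\,u(0)$, where $u(0)=u(0,\dots,0)\in V$ is the basis vector with all indices equal to $0$.
   Context: **Quantum algebra.** $l>3$ is an odd integer, $\varepsilon\in\mathbb C$ a primitive $l$-th root of unity, $I=\{1,\dots,n\}$, $(a_{ij})$ is the Cartan matrix of $\mathfrak{so}(2n+1,\mathbb C)$ with $d=(d_1,\dots,d_n)=(2,\dots,2,1)$, $d_ia_{ij}=d_ja_{ji}$ (so $\alpha_n$ is the short simple root), $\varepsilon_i=\varepsilon^{d_i}$, $[k]_{\varepsilon_i}=\frac{\varepsilon_i^k-\varepsilon_i^{-k}}{\varepsilon_i-\varepsilon_i^{-1}}$, $[k]_{\varepsilon_i}!=[k]_{\varepsilon_i}\cdots[1]_{\varepsilon_i}$. $U_\varepsilon=U_\varepsilon(\mathfrak g)$ is the associative $\mathbb C$-algebra with generators $e_i,f_i,t_i^{\pm1}$ ($i\in I$) and relations $t_it_i^{-1}=t_i^{-1}t_i=1$, $t_it_j=t_jt_i$, $t_ie_jt_i^{-1}=\varepsilon_i^{a_{ij}}e_j$, $t_if_jt_i^{-1}=\varepsilon_i^{-a_{ij}}f_j$,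 $e_if_j-f_je_i=\delta_{ij}\frac{t_i-t_i^{-1}}{\varepsilon_i-\varepsilon_i^{-1}}$, and for $i\ne j$, $\sum_{k=0}^{1-a_{ij}}(-1)^ke_i^{(k)}e_je_i^{(1-a_{ij}-k)}=0=\sum_{k=0}^{1-a_{ij}}(-1)^kf_i^{(k)}f_jf_i^{(1-a_{ij}-k)}$, where $e_i^{(k)}=e_i^k/[k]_{\varepsilon_i}!$, $f_i^{(k)}=f_i^k/[k]_{\varepsilon_i}!$. **The space $V$ and operators.** $V=(\mathbb C^l)^{\otimes n^2}$ has basis $u(m)$, $m=(m_{ij})_{1\le i,j\le n}$, $0\le m_{ij}\le l-1$; indices $m_{ij}$ are read modulo $l$. Put $b_{ij}=1-i+j$ for $i\le j\le n-1$, $b_{in}=2n+1-2i$ for $1\le i\le n$, and $b_{ij}=2n+1-i-j$ for $i>j$. Let $\epsilon_{ij}$ be the unit index vector at $(i,j)$. Define invertible operators $x_{i,j}u(m)=u(m-\epsilon_{ij})$ and $z_{i,j}u(m)=\varepsilon^{m_{ij}+b_{ij}}u(m)$ (this is the specialization $a^{(0)}=(1)_{i,j}$, $b^{(0)}=(\varepsilon^{b_{ij}})_{i,j}$ of the parameters). For an invertible operator $h$ and $d\ne0$ put $\{h\}_{\varepsilon^d}=\frac{h-h^{-1}}{\varepsilon^d-\varepsilon^{-d}}$, $\{h\}=\{h\}_\varepsilon$. For $c\in\mathbb C$, $\varepsilon^c=\exp(c\log\varepsilon)$ for a fixed choice of $\log\varepsilon$. Empty products are $1$, empty sums are $0$.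 **The module (Schnizer).** The following operators define a $U_\varepsilon$-module structure $\Phi_{\lambda,a^{(0)},b^{(0)}}$ on $V$: $e_1=F_{1,1}$; $e_j=(\prod_{k=1}^{j-1}D_{k,j})F_{j,j}+\sum_{q=1}^{j-1}(\prod_{p=1}^{q-1}D_{p,j})C_{q,j}$ ($2\le j\le n$); $t_j=T_{1,j}^{-1}$ ($1\le j\le n$); $f_1=E_{1,1}$; $f_j=E_{j,j}+\sum_{i=1}^{j-1}B_{i,j}$ ($2\le j\le n$), where $C_{i,j}=\{z_{i,j-1}^2z_{i,j}^{-2}\}_{\varepsilon^2}x_{i,j}+\{z_{j+1,i}^2z_{j,i}^{-2}\}_{\varepsilon^2}x_{i,j-1}^{-1}x_{i,j}x_{j,i}$ ($1\le i<j\le n-1$); $C_{i,n}=\{z_{i,n-1}^2z_{i,n}^{-1}\}x_{i,n}+\{z_{n,i}^{-2}z_{i,n}\}x_{i,n-1}^{-1}x_{i,n}x_{n,i}$ ($1\le i<n$); $D_{i,j}=x_{i,j-1}^{-1}x_{i,j}x_{j+1,i}^{-1}x_{j,i}$ ($1\le i<j\le n-1$), $D_{i,n}=x_{i,n-1}^{-1}x_{n,i}$ ($1\le i<n$); $F_{j,j}=\{z_{j,j}^{-2}\}_{\varepsilon^2}x_{j,j}$ ($1\le j\le n-1$), $F_{n,n}=\{z_{n,n}^{-1}\}x_{n,n}$; $T_{i,j}=(\prod_{k=i}^{j-1}A_{k,j})T_{j,j}$ ($1\le i<j\le n$); $A_{i,j}=z_{i,j-1}^{-2}z_{i,j}^4z_{i,j+1}^{-2}z_{j+2,i}^{-2}z_{j+1,i}^4z_{j,i}^{-2}$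 ($1\le i<j\le n-2$), $A_{i,n-1}=z_{i,n-2}^{-2}z_{i,n-1}^4z_{i,n}^{-2}z_{n,i}^4z_{n-1,i}^{-2}$ ($1\le i<n-1$), $A_{i,n}=z_{i,n-1}^{-2}z_{i,n}^2z_{n,i}^{-2}$ ($1\le i<n$); $T_{j,j}=z_{j,j}^4z_{j,j+1}^{-2}z_{j+2,j}^{-2}z_{j+1,j}^4z_{j+1,j+1}^{-2}z_{j+2,j+1}^{-2}\varepsilon^{\lambda_j}$ ($1\le j\le n-2$), $T_{n-1,n-1}=z_{n-1,n-1}^4z_{n-1,n}^{-2}z_{n,n-1}^4z_{n,n}^{-2}\varepsilon^{\lambda_{n-1}}$, $T_{n,n}=z_{n,n}^2\varepsilon^{\lambda_n}$; $B_{i,j}=\{z_{i,j}^2z_{i,j+1}^{-2}z_{j+2,i}^{-2}z_{j+1,i}^4z_{j,i}^{-2}T_{i+1,j}\}_{\varepsilon^2}x_{i,j}^{-1}+\{z_{j+1,i}^2z_{j,i}^{-2}T_{i+1,j}\}_{\varepsilon^2}x_{j+1,i}^{-1}$ ($1\le i<j\le n-2$); $B_{i,n-1}=\{z_{i,n-1}^2z_{i,n}^{-2}z_{n,i}^4z_{n-1,i}^{-2}T_{i+1,n-1}\}_{\varepsilon^2}x_{i,n-1}^{-1}+\{z_{n,i}^2z_{n-1,i}^{-2}T_{i+1,n-1}\}_{\varepsilon^2}x_{n,i}^{-1}$ ($1\le i<n-1$); $B_{i,n}=\{z_{i,n}z_{n,i}^{-2}T_{i+1,n}\}x_{i,n}^{-1}$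 ($1\le i<n$); $E_{j,j}=\{z_{j,j}^2z_{j,j+1}^{-2}z_{j+2,j}^{-2}z_{j+1,j}^4z_{j+1,j+1}^{-2}z_{j+2,j+1}^{-2}\varepsilon^{\lambda_j}\}_{\varepsilon^2}x_{j,j}^{-1}+\{z_{j+1,j}^2z_{j+1,j+1}^{-2}z_{j+2,j+1}^{-2}\varepsilon^{\lambda_j}\}_{\varepsilon^2}x_{j+1,j}^{-1}$ ($1\le j\le n-2$); $E_{n-1,n-1}=\{z_{n-1,n-1}^2z_{n-1,n}^{-2}z_{n,n-1}^4z_{n,n}^{-2}\varepsilon^{\lambda_{n-1}}\}_{\varepsilon^2}x_{n-1,n-1}^{-1}+\{z_{n,n-1}^2z_{n,n}^{-2}\varepsilon^{\lambda_{n-1}}\}_{\varepsilon^2}x_{n,n-1}^{-1}$; $E_{n,n}=\{z_{n,n}\varepsilon^{\lambda_n}\}x_{n,n}^{-1}$. *)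

(* Defs.v *)
From HB Require Import structures.
From mathcomp Require Import all_boot all_order all_algebra.
From mathcomp Require Import reals sequences exp trigo.
From mathcomp Require Import complex.

Set Implicit Arguments.
Unset Strict Implicit.
Unset Printing Implicit Defensive.

Import Order.TTheory GRing.Theory Num.Theory.
Local Open Scope ring_scope.

Definition cexp (R : realType) (w : R[i]) : R[i] :=
  (expR (complex.Re w))%:C%C *
  (cos (complex.Im w) +i* sin (complex.Im w))%C.

(* Indices are 1-based, as in the usual formulas: position [i] of a family
   [f : 'I_n -> T] is [f] at the ordinal [i - 1], for i >= 1; the default [d] is
   only reached when [i] exceeds [n]. *)
Definition at1 (n : nat) (T : Type) (d : T) (f : 'I_n -> T) (i : nat) : T :=
  oapp f d (insub i.-1).

(* The basis indices m = (m_ij); entries are added modulo l (for l > 1). *)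
Notation multi_index n l := 'M['Z_l]_n.

Definition entry (n l : nat) (m : multi_index n l) (i j : nat) : 'Z_l :=
  at1 0 (fun a => at1 0 (m a) j) i.

Definition unit_index (n l : nat) (i j : nat) : multi_index n l :=
  \matrix_(a, b) ((a.+1 == i) && (b.+1 == j))%:R.

(* (C^l)^{\otimes n^2}, in coordinates with respect to the basis u(m). *)
Definition schnizer_space (R : realType) (n l : nat) : vectType R[i] :=
  {ffun multi_index n l -> R[i]^o}.

Definition basis_vector (R : realType) (n l : nat) (m : multi_index n l) :
  schnizer_space R n l := [ffun m' => (m' == m)%:R].

(* Linear operators on V, as a unit ring for composition:
   (f * g) v = f (g v), and f^-1 is the inverse operator of an invertible f. *)
Definition operator (R : realType) (n l : nat) :=
  'End(schnizer_space R n l).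

Section OperatorRing.

Variables (R : realType) (n l : nat).
Local Notation V := (schnizer_space R n l).
Local Notation operator := (operator R n l).

HB.instance Definition _ := GRing.Lmodule.on operator.

Lemma schnizer_space_proper : (0 < dim V)%N.
Proof.
rewrite lt0n; apply/eqP => V0.
have /ffunP/(_ 0) : basis_vector R (0 : multi_index n l) = 0.
  apply: (can_inj (@VectorInternalTheory.v2rK _ V)).
  move: (VectorInternalTheory.v2r _) (VectorInternalTheory.v2r _).
  by rewrite V0 => a b; rewrite !thinmx0.
by rewrite !ffunE eqxx => /eqP; rewrite oner_eq0.
Qed.

HB.instance Definition _ : GRing.Zmodule_isNzRing operator :=
  lfun_comp_nzRingMixin schnizer_space_proper.

Implicit Types f g : operator.

Lemma operator_mulE f g (v : V) : (f * g) v = f (g v).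
Proof. exact: comp_lfunE. Qed.

Lemma operator_1E (v : V) : (1 : operator) v = v.
Proof. exact: id_lfunE. Qed.

Definition operator_inv f : operator :=
  if lker f == 0%VS then f^-1%VF else f.

Fact operator_mulVr : {in [pred f | lker f == 0%VS],
  left_inverse 1 operator_inv *%R}.
Proof. by move=> f; rewrite inE => Uf; rewrite /operator_inv Uf; exact: lker0_compVf. Qed.

Fact operator_mulrV : {in [pred f | lker f == 0%VS],
  right_inverse 1 operator_inv *%R}.
Proof. by move=> f; rewrite inE => Uf; rewrite /operator_inv Uf; exact: lker0_compfV. Qed.

Fact operator_unitP f g : g * f = 1 /\ f * g = 1 -> lker f == 0%VS.
Proof.
case=> gf1 _; apply/lker0P; apply: (can_inj (g := g)) => v.
by rewrite -operator_mulE gf1 operator_1E.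
Qed.

Fact operator_inv_out : {in [predC [pred f | lker f == 0%VS]],
  operator_inv =1 id}.
Proof. by move=> f; rewrite !inE => /negPf nUf; rewrite /operator_inv nUf. Qed.

HB.instance Definition _ := GRing.NzRing_hasMulInverse.Build operator
  operator_mulVr operator_mulrV operator_unitP operator_inv_out.

End OperatorRing.

Section OnBasis.

Variables (R : realType) (n l : nat).
Local Notation V := (schnizer_space R n l).
Local Notation u := (@basis_vector R n l).

Definition on_basis_fun (g : multi_index n l -> V) (v : V) : V :=
  \sum_m v m *: g m.

Fact on_basis_fun_linear g : linear (on_basis_fun g).
Proof.
move=> a v w; rewrite /on_basis_fun scaler_sumr -big_split /=.
by apply: eq_bigr => m _; rewrite !ffunE scalerDl scalerA.
Qed.

HB.instance Definition _ g :=
  GRing.isLinear.Build R[i] V V _ (on_basis_fun g) (on_basis_fun_linear g).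

Definition on_basis (g : multi_index n l -> V) : operator R n l :=
  linfun (on_basis_fun g).

Lemma on_basisE g m : on_basis g (u m) = g m.
Proof.
rewrite lfunE /= /on_basis_fun (bigD1 m) //= big1 => [|m' /negPf m'm].
  by rewrite ffunE eqxx scale1r addr0.
by rewrite ffunE m'm scale0r.
Qed.

End OnBasis.

Module Schnizer.

Section Operators.

Variables (R : realType) (n l : nat).
Local Notation C := R[i].
Local Notation operator := (operator R n l).
Local Notation u := (@basis_vector R n l).

(* [loge] is the chosen logarithm of [eps]. *)
Variables (eps loge : C) (lambda : 'rV[C]_n).

Definition eps_lambda (j : nat) : C := cexp (at1 0 (lambda 0) j * loge).

(* For 1 <= i, j <= n no subtraction below is truncated. *)
Definition b (i j : nat) : nat :=
  if (j < i)%N then (2 * n + 1 - i - j)%N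
  else if j == n then (2 * n + 1 - 2 * i)%N
  else (1 + j - i)%N.

Definition x (i j : nat) : operator :=
  on_basis (fun m => u (m - unit_index n l i j)).

Definition z (i j : nat) : operator :=
  on_basis (fun m => eps ^+ (entry m i j + b i j) *: u m).

Definition brace (d : nat) (h : operator) : operator :=
  (eps ^+ d - eps ^- d)^-1 *: (h - h^-1).

Local Notation "'{|' h '|}_' d" := (brace d h)
  (at level 0, h at level 99, d at level 2, format "{| h |}_ d").

Definition opC (i j : nat) : operator :=
  if j == n then
    {| z i n.-1 ^+ 2 * (z i n)^-1 |}_1 * x i n
    + {| z n i ^- 2 * z i n |}_1 * (x i n.-1)^-1 * x i n * x n i
  else
    {| z i j.-1 ^+ 2 * z i j ^- 2 |}_2 * x i j
    + {| z j.+1 i ^+ 2 * z j i ^- 2 |}_2 * (x i j.-1)^-1 * x i j * x j i.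

Definition opD (i j : nat) : operator :=
  if j == n then (x i n.-1)^-1 * x n i
  else (x i j.-1)^-1 * x i j * (x j.+1 i)^-1 * x j i.

(* F_{j,j} *)
Definition opF (j : nat) : operator :=
  if j == n then {| (z n n)^-1 |}_1 * x n n
  else {| z j j ^- 2 |}_2 * x j j.

Definition opA (i j : nat) : operator :=
  if j == n then
    z i n.-1 ^- 2 * z i n ^+ 2 * z n i ^- 2
  else if j == n.-1 then
    z i n.-2 ^- 2 * z i n.-1 ^+ 4 * z i n ^- 2 * z n i ^+ 4 * z n.-1 i ^- 2
  else
    z i j.-1 ^- 2 * z i j ^+ 4 * z i j.+1 ^- 2
    * z j.+2 i ^- 2 * z j.+1 i ^+ 4 * z j i ^- 2.

Definition opTdiag (j : nat) : operator :=
  if j == n then eps_lambda n *: z n n ^+ 2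
  else if j == n.-1 then
    eps_lambda n.-1 *:
      (z n.-1 n.-1 ^+ 4 * z n.-1 n ^- 2 * z n n.-1 ^+ 4 * z n n ^- 2)
  else
    eps_lambda j *:
      (z j j ^+ 4 * z j j.+1 ^- 2 * z j.+2 j ^- 2 * z j.+1 j ^+ 4
       * z j.+1 j.+1 ^- 2 * z j.+2 j.+1 ^- 2).

(* T_{i,j}; the product is empty for i = j. *)
Definition opT (i j : nat) : operator :=
  (\prod_(i <= k < j) opA k j) * opTdiag j.

Definition opB (i j : nat) : operator :=
  if j == n then
    {| z i n * z n i ^- 2 * opT i.+1 n |}_1 * (x i n)^-1
  else if j == n.-1 then
    {| z i n.-1 ^+ 2 * z i n ^- 2 * z n i ^+ 4 * z n.-1 i ^- 2
       * opT i.+1 n.-1 |}_2 * (x i n.-1)^-1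
    + {| z n i ^+ 2 * z n.-1 i ^- 2 * opT i.+1 n.-1 |}_2 * (x n i)^-1
  else
    {| z i j ^+ 2 * z i j.+1 ^- 2 * z j.+2 i ^- 2 * z j.+1 i ^+ 4 * z j i ^- 2
       * opT i.+1 j |}_2 * (x i j)^-1
    + {| z j.+1 i ^+ 2 * z j i ^- 2 * opT i.+1 j |}_2 * (x j.+1 i)^-1.

(* E_{j,j} *)
Definition opE (j : nat) : operator :=
  if j == n then {| eps_lambda n *: z n n |}_1 * (x n n)^-1
  else if j == n.-1 then
    {| eps_lambda n.-1 *:
       (z n.-1 n.-1 ^+ 2 * z n.-1 n ^- 2 * z n n.-1 ^+ 4 * z n n ^- 2) |}_2
      * (x n.-1 n.-1)^-1
    + {| eps_lambda n.-1 *: (z n n.-1 ^+ 2 * z n n ^- 2) |}_2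
      * (x n n.-1)^-1
  else
    {| eps_lambda j *:
       (z j j ^+ 2 * z j j.+1 ^- 2 * z j.+2 j ^- 2 * z j.+1 j ^+ 4
        * z j.+1 j.+1 ^- 2 * z j.+2 j.+1 ^- 2) |}_2 * (x j j)^-1
    + {| eps_lambda j *:
         (z j.+1 j ^+ 2 * z j.+1 j.+1 ^- 2 * z j.+2 j.+1 ^- 2) |}_2
      * (x j.+1 j)^-1.

(* For j = 1 the sums and products below are empty, so that e_1 = F_{1,1} and
   f_1 = E_{1,1}. *)
Definition e (j : nat) : operator :=
  (\prod_(1 <= k < j) opD k j) * opF j
  + \sum_(1 <= q < j) (\prod_(1 <= p < q) opD p j) * opC q j.

Definition f (j : nat) : operator := opE j + \sum_(1 <= i < j) opB i j.

Definition t (j : nat) : operator := (opT 1 j)^-1.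

End Operators.

End Schnizer.

(* Generators e_i, f_i, t_i, t_i^-1 of U_eps(so(2n+1)), where the ordinal i
   stands for the simple root number i + 1. *)
Variant generator (n : nat) : Type :=
  | Ue of 'I_n | Uf of 'I_n | Ut of 'I_n | UtV of 'I_n.

(* The action of the generators in the module
   \Phi_{lambda, a^(0), b^(0)}. *)
Definition schnizer_action (R : realType) (n l : nat) (eps loge : R[i])
    (lambda : 'rV[R[i]]_n) (g : generator n) : operator R n l :=
  match g with
  | Ue i => @Schnizer.e R n l eps i.+1
  | Uf i => @Schnizer.f R n l eps loge lambda i.+1
  | Ut i => @Schnizer.t R n l eps loge lambda i.+1
  | UtV i => (@Schnizer.t R n l eps loge lambda i.+1)^-1
  end.

(* Main.v *)
From HB Require Import structures.
Require Import Defs.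
From mathcomp Require Import all_boot all_order all_algebra.
From mathcomp Require Import reals complex.
From mathcomp Require Import zify ring.

(** In coordinates, every x_ij is a translation of the index m and every
    expression in the z_ij is diagonal, so each e_j is a sum of terms
    'translation after diagonal'. Group the indices into hooks: the p-th hook
    consists of the entries (p,j) and (j,p) with j >= p. Truncating the formula
    for e_j to the hooks p, p+1, ... gives operators T_(p,j) ([etail p j]) with
    T_(1,j) = e_j, T_(p,p) = F_(p,p) and
      T_(p,j) = C_(p,j) + D_(p,j) T_(p+1,j)    (p < j).
    Once the shifts b_ij are absorbed, this recursion reads ([etail_step])
      T_(p,j) = x_pj a_1 + S (a_2 + x_g^-1 T_(p+1,j)),
    where S translates by e_(p,j-1) - e_(p,j) - e_(j,p), the diagonal a_1 is the
    bracket of a combination of m_(p,j-1) and m_(p,j), the diagonal a_2 is the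
    bracket of a combination of m_g and m_(j,p), and the guard g is the position
    preceding (j,p) in the order (p,p), ..., (p,n), (n,p), ..., (p+1,p) of the
    hook.

    Let T_(p,j) v = 0 for all j >= p. If v lives on m_(p,j-1) = 0, then x_pj a_1 v
    lives there as well, whereas S(...) lives on m_(p,j-1) = 1, because T_(p+1,j)
    does not touch hook p. The two parts vanish separately, and a_1 v = 0 forces
    m_(p,j) = 0 on the support of v, since the bracket of k vanishes only for
    k = 0 modulo l ([etail_row_entry]). Starting from T_(p,p) = F_(p,p), this
    clears the row part of the hook for increasing j. What is left is
    a_2 v + x_g^-1 T_(p+1,j) v = 0, whose terms live on m_g = 0 and m_g = 1 as
    soon as v lives on m_g = 0; so a_2 v = 0, which gives m_(j,p) = 0, and
    T_(p+1,j) v = 0 ([etail_column_entry]). For decreasing j this clears the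
    column part and leaves the same hypothesis for hook p + 1 ([etail_hook]).
    After the last hook v is supported at m = 0. Conversely every bracket
    vanishes at m = 0, so u(0) is killed by all T_(p,j). *)

Import GRing.Theory Num.Theory.
Local Open Scope ring_scope.

Set Implicit Arguments.
Unset Strict Implicit.
Unset Printing Implicit Defensive.

(** * Diagonal operators and translations *)

Lemma invr_of_inverse (S : unitRingType) (a c : S) :
  c * a = 1 -> a * c = 1 -> a^-1 = c.
Proof.
move=> ca1 ac1; have Ua : a \is a GRing.unit by apply/unitrP; exists c.
by apply: (mulrI Ua); rewrite mulrV.
Qed.

(** Locked, as is [shift]: unification that fails on two such operators would
    otherwise unfold them down to matrices and complex arithmetic. *)
HB.lock Definition diag (R : realType) (n l : nat)
    (phi : multi_index n l -> R[i]) : operator R n l :=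
  on_basis (fun m => phi m *: basis_vector R m).
Arguments diag {R n l}.

HB.lock Definition shift (R : realType) (n l : nat) (s : multi_index n l) :
    operator R n l :=
  on_basis (fun m => basis_vector R (m - s)).
Arguments shift {R n l}.

Section DiagonalAndShift.

Variables (R : realType) (n l : nat).
Local Notation C := R[i].
Local Notation V := (schnizer_space R n l).
Local Notation op := (operator R n l).
Local Notation u := (@basis_vector R n l).
Implicit Types (m s : multi_index n l) (v : V) (phi psi : multi_index n l -> C).

Lemma on_basis_coord (g : multi_index n l -> V) v m :
  on_basis g v m = \sum_m' (v m' : C) * g m' m :> C.
Proof.
rewrite /on_basis lfunE /= /on_basis_fun sum_ffunE.
by apply: eq_bigr => m' _; rewrite ffunE.
Qed.

Lemma diagE phi v m : diag phi v m = phi m * v m :> C.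
Proof.
rewrite diag.unlock on_basis_coord (bigD1 m) //= big1 => [|m' m'm].
  by rewrite addr0 2!ffunE eqxx [X in v m * X](mulr1 (phi m)) mulrC.
by rewrite 2!ffunE eq_sym (negPf m'm) [X in v m' * X](mulr0 (phi m')) mulr0.
Qed.

Lemma shiftE s v m : shift s v m = v (m + s).
Proof.
rewrite shift.unlock on_basis_coord (bigD1 (m + s)) //= big1 => [|m' m'm].
  by rewrite addr0 ffunE addrK eqxx mulr1.
by rewrite ffunE eq_sym subr_eq (negPf m'm) mulr0.
Qed.

Lemma operatorP (f g : op) : (forall v m, f v m = g v m) -> f = g.
Proof. by move=> fg; apply/lfunP => v; apply/ffunP => m. Qed.

Lemma shiftM s s' : shift s * shift s' = shift (s + s') :> op.
Proof.
by apply: operatorP => v m; rewrite [RHS]shiftE operator_mulE !shiftE addrA.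
Qed.

Lemma shift0 : shift 0 = 1 :> op.
Proof. by apply: operatorP => v m; rewrite shiftE addr0 operator_1E. Qed.

Lemma shiftV s : (shift s : op)^-1 = shift (- s).
Proof. by apply: invr_of_inverse; rewrite shiftM (subrr, addNr) shift0. Qed.

Lemma shift_eq0 s v : shift s v = 0 -> v = 0.
Proof.
by move=> sv0; apply/ffunP => m; rewrite -(subrK s m) -shiftE sv0 !ffunE.
Qed.

Lemma diagM phi psi : diag phi * diag psi = diag (fun m => phi m * psi m).
Proof.
by apply: operatorP => v m; rewrite [RHS]diagE operator_mulE !diagE mulrA.
Qed.

Lemma diag1 : diag (fun=> 1) = 1 :> op.
Proof. by apply: operatorP => v m; rewrite diagE mul1r operator_1E. Qed.

Lemma eq_diag phi psi : phi =1 psi -> diag phi = diag psi.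
Proof. by move=> e; apply: operatorP => v m; rewrite !diagE e. Qed.

Lemma diag_shift phi s :
  diag phi * shift s = shift s * diag (fun m => phi (m - s)).
Proof.
apply: operatorP => v m; rewrite operator_mulE diagE shiftE.
by rewrite operator_mulE shiftE diagE addrK.
Qed.

Lemma diag_basis phi m : diag phi (u m) = phi m *: u m.
Proof. by rewrite diag.unlock on_basisE. Qed.

End DiagonalAndShift.

(** * Entries of indices *)

Section Entries.

Variables (n l : nat).
Implicit Types m s : multi_index n l.

Lemma entryE m a b (ha : (a.-1 < n)%N) (hb : (b.-1 < n)%N) :
  entry m a b = m (Ordinal ha) (Ordinal hb).
Proof. by rewrite /entry /at1 !insubT. Qed.

Lemma entryD m s a b : entry (m + s) a b = entry m a b + entry s a b.
Proof.
rewrite /entry /at1; case: (insub a.-1) => [i|] /=; last by rewrite addr0.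
by case: (insub b.-1) => [j|] /=; rewrite ?mxE ?addr0.
Qed.

Lemma entryN m a b : entry (- m) a b = - entry m a b.
Proof.
rewrite /entry /at1; case: (insub a.-1) => [i|] /=; last by rewrite oppr0.
by case: (insub b.-1) => [j|] /=; rewrite ?mxE ?oppr0.
Qed.

Lemma entry0 a b : entry (0 : multi_index n l) a b = 0.
Proof.
rewrite /entry /at1; case: (insub a.-1) => [i|] //=.
by case: (insub b.-1) => [j|] //=; rewrite mxE.
Qed.

Lemma entry_unit i j a b : (0 < a <= n)%N -> (0 < b <= n)%N ->
  entry (unit_index n l i j) a b = ((a == i) && (b == j))%:R.
Proof.
move=> ha hb.
have ha' : (a.-1 < n)%N by lia.
have hb' : (b.-1 < n)%N by lia.
by rewrite entryE mxE /= !prednK //; lia.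
Qed.

End Entries.

(** * Quantum integers at a root of unity *)

Section Brackets.

Variables (R : realType) (l : nat) (eps : R[i]).
Hypotheses (hl : (3 < l)%N) (hlodd : odd l) (heps : l.-primitive_root eps).
Implicit Types a c : 'Z_l.

Let l_gt1 : (1 < l)%N. Proof. by lia. Qed.

(** As eps has order l, its powers depend on the exponent modulo l only: this is
    the resulting character of the additive group of Z/l. *)
Definition chi a : R[i] := eps ^+ a.

Lemma chi_nat k : chi k%:R = eps ^+ k.
Proof. by rewrite /chi val_Zp_nat // (prim_expr_mod heps). Qed.

Lemma chiD a c : chi (a + c) = chi a * chi c.
Proof. by rewrite -(natr_Zp a) -(natr_Zp c) -natrD !chi_nat exprD. Qed.

Lemma chi0 : chi 0 = 1.
Proof. exact: expr0. Qed.

Lemma chiN a : chi (- a) = (chi a)^-1.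
Proof.
by symmetry; apply: invr_of_inverse; rewrite -chiD (subrr, addNr) chi0.
Qed.

Lemma chi_eq1 a : (chi a == 1) = (a == 0).
Proof.
rewrite /chi -(prim_order_dvd heps); have ltal : (a < l)%N.
  by rewrite -[X in (_ < X)%N](Zp_cast l_gt1).
apply/idP/eqP => [dvdla | ->]; last exact: dvdn0.
have [a0|a_gt0] := posnP a; first exact: val_inj.
by rewrite gtnNdvd in dvdla.
Qed.

Lemma double_eq0 a : (a *+ 2 == 0) = (a == 0).
Proof.
have dvdE k : ((k%:R : 'Z_l) == 0) = (l %| k)%N.
  by rewrite -chi_eq1 chi_nat (prim_order_dvd heps).
by rewrite -(natr_Zp a) -mulrnA !dvdE mulnC Gauss_dvdr // coprimen2.
Qed.

(** The quantum integer [a / d] at eps^d; it makes sense for a modulo l. *)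
Definition bracket (d : nat) a : R[i] :=
  (eps ^+ d - eps ^- d)^-1 * (chi a - chi (- a)).

Lemma bracket0 d : bracket d 0 = 0.
Proof. by rewrite /bracket oppr0 subrr mulr0. Qed.

Lemma chi_subN_eq0 a : (chi a - chi (- a) == 0) = (a == 0).
Proof.
have chi_neq0 : chi (- a) != 0.
  apply/eqP => ch0; have /eqP := chiD a (- a).
  by rewrite ch0 mulr0 subrr chi0 oner_eq0.
rewrite subr_eq0 -double_eq0 -chi_eq1 -[RHS](inj_eq (mulIf chi_neq0)).
by rewrite mul1r mulr2n -chiD addrK.
Qed.

(** The denominator eps^d - eps^-d is nonzero for the same reason as the
    numerator: d is not divisible by l. *)
Lemma bracket_eq0 d a : (0 < d < 3)%N -> (bracket d a == 0) = (a == 0).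
Proof.
move=> hd; rewrite mulf_eq0 invr_eq0 -chi_nat -chiN !chi_subN_eq0.
rewrite -chi_eq1 chi_nat -(prim_order_dvd heps) gtnNdvd //; lia.
Qed.

End Brackets.

(** * Normal forms of the operators C, D and F *)

Section SchnizerOperators.

Variables (R : realType) (n l : nat) (eps : R[i]).
Hypotheses (hl : (3 < l)%N) (hlodd : odd l) (heps : l.-primitive_root eps).
Local Notation V := (schnizer_space R n l).
Local Notation op := (operator R n l).
Local Notation u := (@basis_vector R n l).
Local Notation "'e_ i , j" := (unit_index n l i j)
  (at level 8, i at level 2, j at level 2).
Local Notation x := (Schnizer.x R n l).
Local Notation z := (Schnizer.z n l eps).
Local Notation opC := (Schnizer.opC n l eps).
Local Notation opD := (Schnizer.opD R n l).
Local Notation opF := (Schnizer.opF n l eps).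
Implicit Types (m s : multi_index n l) (v w : V).

Lemma entry_unit_id i j : (0 < i <= n)%N -> (0 < j <= n)%N ->
  entry 'e_i,j i j = 1.
Proof. by move=> hi hj; rewrite entry_unit // !eqxx. Qed.

Lemma entry_unit_neq i j a c : (0 < a <= n)%N -> (0 < c <= n)%N ->
  (a != i) || (c != j) -> entry 'e_i,j a c = 0.
Proof. by move=> ha hc; rewrite entry_unit // -negb_and => /negPf ->. Qed.

Lemma xE i j : x i j = shift 'e_i,j.
Proof. by rewrite shift.unlock. Qed.

(** Laurent monomials in the z_ij, with their exponents written additively. *)
Definition phase (kappa : multi_index n l -> 'Z_l) : op :=
  diag (fun m => chi eps (kappa m)).

Lemma zE i j : z i j = phase (fun m => entry m i j + (Schnizer.b n i j)%:R).
Proof.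
transitivity (diag (fun m => eps ^+ (entry m i j + Schnizer.b n i j)) : op).
  by rewrite diag.unlock.
by apply: eq_diag => m; rewrite chiD ?chi_nat // exprD.
Qed.

Lemma phaseM k1 k2 : phase k1 * phase k2 = phase (fun m => k1 m + k2 m).
Proof. by rewrite /phase diagM; apply: eq_diag => m; rewrite chiD. Qed.

Lemma phase_cst0 : phase (fun=> 0) = 1.
Proof. by rewrite -diag1; apply: eq_diag => m; rewrite chi0. Qed.

Lemma phaseV k : (phase k)^-1 = phase (fun m => - k m).
Proof.
apply: invr_of_inverse; rewrite phaseM -phase_cst0; apply: eq_diag => m.
  by rewrite addNr.
by rewrite subrr.
Qed.

Lemma phaseX k r : phase k ^+ r = phase (fun m => k m *+ r).
Proof.
elim: r => [|r IHr]; first by rewrite expr0 -phase_cst0.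
by rewrite exprS IHr phaseM; apply: eq_diag => m; rewrite mulrS.
Qed.

Lemma brace_phase d k :
  Schnizer.brace eps d (phase k) = diag (fun m => bracket eps d (k m)).
Proof.
apply: operatorP => v m; rewrite [RHS]diagE /Schnizer.brace phaseV.
have -> : ((eps ^+ d - eps ^- d)^-1 *: (phase k - phase (fun i => - k i))) v m
    = (eps ^+ d - eps ^- d)^-1
      * (phase k v m - phase (fun i => - k i) v m) :> R[i].
  by rewrite scale_lfunE ffunE add_lfunE ffunE opp_lfunE ffunE.
by rewrite /phase !diagE -mulrBl mulrA.
Qed.

Definition zmonE := (zE, phaseX, phaseV, phaseM, brace_phase, xE, shiftV).

(** The integer d_j, for which eps_j = eps^d_j. *)
Definition charge (j : nat) : nat := if j == n then 1 else 2.

(** The position preceding (j,p) along the hook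
    (p,p), ..., (p,n), (n,p), ..., (p+1,p). *)
Definition guard (p j : nat) : nat * nat := if j == n then (p, n) else (j.+1, p).

(** The translation x_(p,j-1)^-1 x_(p,j) x_(j,p), common to the second term of
    C_(p,j) and to D_(p,j). *)
Definition slide (p j : nat) : multi_index n l :=
  - 'e_p,j.-1 + ('e_p,j + 'e_j,p).

Definition weight_row (p j : nat) m : 'Z_l :=
  if j == n then entry m p j.-1 *+ 2 - entry m p j
  else (entry m p j.-1 - entry m p j) *+ 2.

Definition weight_column (p j : nat) m : 'Z_l :=
  if j == n then entry m p n - entry m n p *+ 2
  else (entry m j.+1 p - entry m j p) *+ 2.

Definition opC_row p j : op :=
  diag (fun m => bracket eps (charge j) (weight_row p j m)).

Definition opC_column p j : op :=
  diag (fun m => bracket eps (charge j) (weight_column p j m)).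

Definition unguard p j : multi_index n l :=
  - 'e_((guard p j).1),((guard p j).2).

(** The exponents b_ij are chosen so that no constant remains in the weights
    when the diagonal factor is applied before the translation. *)
Lemma opC_normal p j : (0 < p < j)%N -> (j <= n)%N ->
  opC p j =
    shift 'e_p,j * opC_row p j + shift (slide p j) * opC_column p j.
Proof.
move=> hp hj; rewrite /Schnizer.opC /opC_row /opC_column /charge.
rewrite /weight_row /weight_column.
case: eqP => [jn|j_neq_n]; rewrite !zmonE -!mulrA !shiftM !diag_shift.
  subst j; congr (_ * _ + _ * _); apply: eq_diag => m; congr (bracket _ _ _).
    rewrite !(entryD, entryN) entry_unit_id ?entry_unit_neq; try lia.
    have -> : Schnizer.b n p n = (2 * Schnizer.b n p n.-1 + 1)%N.
      by rewrite /Schnizer.b; do ?case: ifP; lia.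
    by rewrite natrD natrM; ring.
  have /(congr1 (fun k => k%:R : 'Z_l)) :
      (2 * Schnizer.b n n p = Schnizer.b n p n + 1)%N.
    by rewrite /Schnizer.b; do ?case: ifP; lia.
  rewrite natrM natrD => /esym/(canRL (addrK _)) ->.
  rewrite !(entryD, entryN) !entry_unit_id ?entry_unit_neq; try lia.
  ring.
have b_row : Schnizer.b n p j = (Schnizer.b n p j.-1 + 1)%N.
  by rewrite /Schnizer.b; do ?case: ifP; lia.
have b_col : Schnizer.b n j p = (Schnizer.b n j.+1 p + 1)%N.
  by rewrite /Schnizer.b; do ?case: ifP; lia.
congr (_ * _ + _ * _); apply: eq_diag => m; congr (bracket _ _ _).
  rewrite b_row natrD !(entryD, entryN) entry_unit_id ?entry_unit_neq; try lia.
  ring.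
rewrite b_col natrD !(entryD, entryN) !entry_unit_id ?entry_unit_neq; try lia.
ring.
Qed.

Lemma opD_normal p j : (0 < p < j)%N -> (j <= n)%N ->
  opD p j = shift (slide p j) * shift (unguard p j).
Proof.
move=> hp hj; rewrite /Schnizer.opD /unguard /guard /slide.
case: eqP => [jn|_]; rewrite !xE !shiftV !shiftM /=; congr shift.
  by subst j; rewrite ['e_p,n + _]addrC addrA addrK.
by rewrite addrAC !addrA.
Qed.

Definition weightF (j : nat) m : 'Z_l :=
  if j == n then - entry m j j else - entry m j j *+ 2.

Lemma opF_normal j : (0 < j <= n)%N ->
  opF j = shift 'e_j,j
          * diag (fun m => bracket eps (charge j) (weightF j m)).
Proof.
move=> hj; rewrite /Schnizer.opF /charge /weightF.
have bjj : Schnizer.b n j j = 1%N by rewrite /Schnizer.b; do ?case: ifP; lia.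
case: eqP => [jn|_].
  subst j; rewrite !zmonE diag_shift; congr (_ * _); apply: eq_diag => m.
  rewrite bjj !(entryD, entryN) entry_unit_id //; congr bracket; ring.
rewrite !zmonE diag_shift; congr (_ * _); apply: eq_diag => m.
rewrite bjj !(entryD, entryN) entry_unit_id //; congr bracket; ring.
Qed.

(** * Truncations of e_j to the last hooks *)

(** The part of e_j that acts on the entries (a,c) with a, c >= p only. *)
Definition etail (p j : nat) : op :=
  (\prod_(p <= k < j) opD k j) * opF j
  + \sum_(p <= q < j) (\prod_(p <= r < q) opD r j) * opC q j.

Lemma etail_diag j : etail j j = opF j.
Proof. by rewrite /etail !big_geq // mul1r addr0. Qed.

Lemma etail_rec p j : (p < j)%N ->
  etail p j = opC p j + opD p j * etail p.+1 j.
Proof.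
move=> ltpj; rewrite /etail big_ltn // (big_ltn ltpj) (big_geq (leqnn p)).
rewrite mul1r addrCA mulrDr mulrA; congr (_ + (_ + _)).
rewrite mulr_sumr big_seq_cond [RHS]big_seq_cond.
apply: eq_bigr => q; rewrite andbT mem_index_iota => /andP[ltpq _].
by rewrite big_ltn // mulrA.
Qed.

(** * Separation by the value of one entry *)

Definition concentrated (a c : nat) (k : 'Z_l) v :=
  forall m, entry m a c != k -> v m = 0.

Lemma concentratedD a c k v w :
  concentrated a c k v -> concentrated a c k w -> concentrated a c k (v + w).
Proof. by move=> cv cw m mk; rewrite ffunE cv // cw // addr0. Qed.

Lemma concentrated_diag a c k phi v :
  concentrated a c k v -> concentrated a c k (diag phi v).
Proof. by move=> cv m mk; rewrite diagE cv // [LHS]mulr0. Qed.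

Lemma concentrated_shift a c k s v :
  concentrated a c k v -> concentrated a c (k - entry s a c) (shift s v).
Proof.
move=> cv m mk; rewrite shiftE cv // entryD.
by apply: contra_neq mk => <-; rewrite addrK.
Qed.

Lemma concentrated_shift_id a c k s v : entry s a c = 0 ->
  concentrated a c k v -> concentrated a c k (shift s v).
Proof. by move=> s0 cv; rewrite -[k]subr0 -s0; exact: concentrated_shift. Qed.

Lemma concentrated_sum_eq0 a c k k' v w : k != k' ->
  concentrated a c k v -> concentrated a c k' w -> v + w = 0 ->
  v = 0 /\ w = 0.
Proof.
move=> kk' cv cw vw0; suff v0 : v = 0 by move: vw0; rewrite v0 add0r.
apply/ffunP => m; rewrite ffunE.
have [mk|/cv //] := eqVneq (entry m a c) k.
have /ffunP/(_ m) := vw0; rewrite !ffunE (cw m) ?mk //.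
by rewrite addr0.
Qed.

Lemma diag_eq0 a c phi v :
  (forall m, v m <> 0 -> phi m = 0 -> entry m a c = 0) -> diag phi v = 0 ->
  concentrated a c 0 v.
Proof.
move=> phi0 dv0 m mac; apply/eqP/negPn/negP => /eqP vm.
have /ffunP/(_ m)/eqP := dv0; rewrite diagE ffunE mulf_eq0.
case/orP => /eqP // /(phi0 _ vm) m0; by rewrite m0 eqxx in mac.
Qed.

(** * Clearing one hook *)

Lemma etail_step p j v : (0 < p < j)%N -> (j <= n)%N ->
  etail p j v = shift 'e_p,j (opC_row p j v)
    + shift (slide p j)
        (opC_column p j v + shift (unguard p j) (etail p.+1 j v)).
Proof.
move=> hp hj; rewrite etail_rec ?opC_normal ?opD_normal //; last lia.
(* Kept abstract, since [etail] unfolds to a sum that [add_lfunE] would split. *)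
move: (etail p.+1 j) => T.
by rewrite !add_lfunE !operator_mulE linearD /= addrA.
Qed.

Lemma entry_slide p j a c : (0 < a <= n)%N -> (0 < c <= n)%N ->
  entry (slide p j) a c =
    - ((a == p) && (c == j.-1))%:R
    + (((a == p) && (c == j))%:R + ((a == j) && (c == p))%:R).
Proof. by move=> ha hc; rewrite !(entryD, entryN) !entry_unit. Qed.

Lemma entry_unguard p j a c : (0 < a <= n)%N -> (0 < c <= n)%N ->
  entry (unguard p j) a c =
    - ((a == (guard p j).1) && (c == (guard p j).2))%:R.
Proof. by move=> ha hc; rewrite entryN !entry_unit. Qed.

(** Truncations starting at hook p leave the entries of the earlier hooks alone. *)
Lemma etail_concentrated a c k p j v :
  (0 < a <= n)%N -> (0 < c <= n)%N -> (a < p)%N || (c < p)%N ->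
  (0 < p <= j)%N -> (j <= n)%N ->
  concentrated a c k v -> concentrated a c k (etail p j v).
Proof.
move=> ha hc acp /andP[p_gt0 lepj] hj cv.
have [d dE] : exists d, d = (j - p)%N by eexists.
elim: d p acp p_gt0 lepj dE => [|d IHd] p acp p_gt0 lepj dE.
  have {dE lepj} pj : p = j by lia.
  subst p; rewrite etail_diag opF_normal ?p_gt0 // operator_mulE.
  apply: concentrated_shift_id (concentrated_diag _ cv).
  by rewrite entry_unit_neq //; lia.
rewrite etail_step; try lia.
apply: concentratedD.
  apply: concentrated_shift_id (concentrated_diag _ cv).
  by rewrite entry_unit_neq //; lia.
apply: concentrated_shift_id.
  rewrite entry_slide; try lia.
  have -> : (a == p) && (c == j.-1) = false by lia.
  have -> : (a == p) && (c == j) = false by lia.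
  have -> : (a == j) && (c == p) = false by lia.
  by rewrite oppr0 !addr0.
apply: concentratedD; first exact: concentrated_diag.
apply: concentrated_shift_id; last by apply: IHd; lia.
rewrite entry_unguard //.
have -> : (a == (guard p j).1) && (c == (guard p j).2) = false.
  by rewrite /guard; case: ifP => /=; lia.
by rewrite oppr0.
Qed.

(** Of the two terms of [etail_step] only the second one changes the entry
    (p,j-1), so the terms vanish separately; the bracket in the first one then
    detects the entry (p,j). *)
Lemma etail_row_entry p j v : (0 < p < j)%N -> (j <= n)%N ->
  etail p j v = 0 -> concentrated p j.-1 0 v ->
  concentrated p j 0 v
  /\ opC_column p j v + shift (unguard p j) (etail p.+1 j v) = 0.
Proof.
move=> hp hj; rewrite etail_step // => ev0 cv.
have [C1v0 tail0] : shift 'e_p,j (opC_row p j v) = 0 /\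
    shift (slide p j)
      (opC_column p j v + shift (unguard p j) (etail p.+1 j v)) = 0.
  apply: (concentrated_sum_eq0 (a := p) (c := j.-1) (k := 0) (k' := 0 - -1)).
  - by rewrite opprK add0r eq_sym oner_eq0.
  - apply: concentrated_shift_id (concentrated_diag _ cv).
    by rewrite entry_unit_neq //; lia.
  - have <- : entry (slide p j) p j.-1 = -1.
      rewrite entry_slide; try lia.
      have -> : (p == p) && (j.-1 == j.-1) by rewrite !eqxx.
      have -> : (p == p) && (j.-1 == j) = false by lia.
      have -> : (p == j) && (j.-1 == p) = false by lia.
      by rewrite !addr0.
    apply/concentrated_shift/concentratedD; first exact: concentrated_diag.
    apply: concentrated_shift_id; last by apply: etail_concentrated => //; lia.
    rewrite entry_unguard; try lia.
    have -> : (p == (guard p j).1) && (j.-1 == (guard p j).2) = false.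
      by rewrite /guard; case: ifP => /=; lia.
    by rewrite oppr0.
  - exact: ev0.
split; last exact: shift_eq0 tail0.
apply: diag_eq0 (shift_eq0 C1v0) => m vm /eqP.
have m0 : entry m p j.-1 = 0.
  by apply/eqP/negPn/negP => /cv.
rewrite bracket_eq0 //; last by rewrite /charge; case: ifP.
rewrite /weight_row m0 mul0rn !sub0r; case: ifP => _.
  by rewrite oppr_eq0 => /eqP.
by rewrite (double_eq0 hl hlodd heps) oppr_eq0 => /eqP.
Qed.

(** The same separation, now by the guard entry: it is unchanged in the first
    summand and raised by 1 in the second. *)
Lemma etail_column_entry p j v : (0 < p < j)%N -> (j <= n)%N ->
  opC_column p j v + shift (unguard p j) (etail p.+1 j v) = 0 ->
  concentrated (guard p j).1 (guard p j).2 0 v ->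
  concentrated j p 0 v /\ etail p.+1 j v = 0.
Proof.
move=> hp hj tail0 gv.
have hg1 : (0 < (guard p j).1 <= n)%N by rewrite /guard; case: ifP => /=; lia.
have hg2 : (0 < (guard p j).2 <= n)%N by rewrite /guard; case: ifP => /=; lia.
have [C2v0 Ev0] :
    opC_column p j v = 0 /\ shift (unguard p j) (etail p.+1 j v) = 0.
  apply: concentrated_sum_eq0 (concentrated_diag _ gv) _ tail0; last first.
    apply: concentrated_shift.
    apply: (etail_concentrated (k := 0)) => //; try lia.
    by rewrite /guard; case: ifP => /=; lia.
  by rewrite entry_unguard // !eqxx opprK add0r eq_sym oner_eq0.
split; last exact: shift_eq0 Ev0.
apply: diag_eq0 C2v0 => m vm /eqP.
have m0 : entry m (guard p j).1 (guard p j).2 = 0.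
  by apply/eqP/negPn/negP => /gv.
rewrite bracket_eq0 //; last by rewrite /charge; case: ifP.
rewrite /weight_column; move: m0; rewrite /guard; case: eqP => [jn|_] /= ->.
  by rewrite sub0r oppr_eq0 (double_eq0 hl hlodd heps) => /eqP; rewrite jn.
by rewrite sub0r (double_eq0 hl hlodd heps) oppr_eq0 => /eqP.
Qed.

(** The row entries are cleared from (p,p) to (p,n), each serving as reference
    for the next one; then the column entries from (n,p) back to (p+1,p), each
    using its guard. *)
Lemma etail_hook p v : (0 < p <= n)%N ->
  (forall j, (p <= j <= n)%N -> etail p j v = 0) ->
  (forall j, (p <= j <= n)%N -> concentrated p j 0 v /\ concentrated j p 0 v)
  /\ (forall j, (p < j <= n)%N -> etail p.+1 j v = 0).
Proof.
move=> hp ev0.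
have vpp : concentrated p p 0 v.
  have := ev0 p; rewrite etail_diag opF_normal // operator_mulE leqnn.
  have -> : (p <= n)%N by lia.
  move=> /(_ isT)/shift_eq0 Fv0; apply: diag_eq0 Fv0 => m _ /eqP.
  rewrite bracket_eq0 //; last by rewrite /charge; case: ifP.
  by rewrite /weightF; case: ifP => _; rewrite ?(double_eq0 hl hlodd heps)
    ?mulNrn oppr_eq0 ?(double_eq0 hl hlodd heps) => /eqP.
have row j : (p <= j <= n)%N -> concentrated p j 0 v.
  elim: j => [|j IHj] hj; first by lia.
  have [<- //|neq] := eqVneq p j.+1.
  have := @etail_row_entry p j.+1 v; case; try lia; first by apply: ev0; lia.
    by apply: IHj; lia.
  by [].
have tail j : (p < j <= n)%N ->
    opC_column p j v + shift (unguard p j) (etail p.+1 j v) = 0.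
  move=> hj; apply etail_row_entry; try lia; first by apply: ev0; lia.
  by apply: row; lia.
(* Descending induction on j = n - d: the guard of (n,p) is (p,n). *)
have column d : (d < n - p)%N ->
    concentrated (n - d) p 0 v /\ etail p.+1 (n - d) v = 0.
  elim: d => [|d IHd] hd; apply: etail_column_entry; try lia;
    try by apply: tail; lia.
    by rewrite /guard subn0 eqxx /=; apply: row; lia.
  rewrite /guard; have -> : (n - d.+1 == n)%N = false by lia.
  rewrite /= -subSn; last lia.
  by rewrite subSS; apply IHd; lia.
split=> j hj; last first.
  by have [|_] := @column (n - j)%N; [lia | rewrite subKn //; lia].
split; first exact: row.
have [<- //|neq] := eqVneq p j.
by have [|] := @column (n - j)%N; [lia | rewrite subKn //; lia].
Qed.

(** * Highest weight vectors *)

Lemma etail_basis0 p j : (0 < p <= j)%N -> (j <= n)%N ->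
  etail p j (u 0) = 0.
Proof.
move=> /andP[p_gt0 lepj] hj; have [d dE] : exists d, d = (j - p)%N by eexists.
elim: d p p_gt0 lepj dE => [|d IHd] p p_gt0 lepj dE.
  have {dE lepj} pj : p = j by lia.
  subst p; rewrite etail_diag opF_normal ?p_gt0 // operator_mulE diag_basis.
  by rewrite /weightF entry0 oppr0 mul0rn if_same bracket0 scale0r linear0.
rewrite etail_step; try lia.
rewrite IHd; try lia.
rewrite /opC_row /opC_column !diag_basis /weight_row /weight_column.
rewrite !entry0 mul0rn subrr mul0rn.
by rewrite if_same bracket0 !(scale0r, linear0, addr0).
Qed.

Lemma highest_weight_vectors v :
  (forall j, (0 < j <= n)%N -> Schnizer.e n l eps j v = 0) <->
  exists c : R[i], v = c *: u 0.
Proof.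
split=> [ev0 | [c ->] j hj]; last first.
  (* e_j is the truncation [etail 1 j]. *)
  by rewrite linearZ /= (@etail_basis0 1) ?scaler0 //; lia.
have strip p : (p <= n)%N ->
    (forall j, (p < j <= n)%N -> etail p.+1 j v = 0)
    /\ (forall a c, (0 < a <= n)%N -> (0 < c <= n)%N ->
         (a <= p)%N || (c <= p)%N -> concentrated a c 0 v).
  elim: p => [|p IHp] hp; first by split=> [//|a c]; lia.
  have [|tail0 conc0] := IHp; first lia.
  have [||rowcol tail0'] := @etail_hook p.+1 v; [lia | exact: tail0 |].
  split=> // a c ha hc acp.
  have [le|gt] := boolP ((a <= p)%N || (c <= p)%N); first exact: conc0.
  have [aE|aE] := eqVneq a p.+1; first by subst a; apply rowcol; lia.
  have cE : c = p.+1 by lia.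
  by subst c; apply rowcol; lia.
exists (v 0); apply/ffunP => m; rewrite !ffunE.
have [->|m_neq0] := eqVneq m 0; first by rewrite [RHS]mulr1.
rewrite [RHS]mulr0.
have /matrix0Pn[a [c mac]] := m_neq0.
have [_ conc0] := strip n (leqnn n).
apply: (conc0 a.+1 c.+1); rewrite ?ltn_ord //.
rewrite (@entryE _ _ _ a.+1 c.+1 (ltn_ord a) (ltn_ord c)).
have ordK (k : 'I_n) (hk : (k.+1.-1 < n)%N) : Ordinal hk = k by exact: val_inj.
by rewrite !ordK.
Qed.

End SchnizerOperators.

Theorem proposition3p9 (R : realType) (n l : nat) (eps loge : R[i])
    (lambda : 'rV[R[i]]_n) (u : schnizer_space R n l)
    (hn : (3 <= n)%N) (hl : (3 < l)%N) (hlodd : odd l)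
    (heps : l.-primitive_root eps) (hloge : cexp loge = eps) :
  (forall i : 'I_n, schnizer_action l eps loge lambda (Ue i) u = 0) <->
  (exists c : R[i], u = c *: basis_vector R (0 : multi_index n l)).
Proof.
rewrite -(@highest_weight_vectors R n l eps hl hlodd heps u).
split=> [eu0 [|j] // hj | eu0 i]; last exact: (eu0 i.+1 (ltn_ord i)).
exact: (eu0 (Ordinal hj)).
Qed.
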